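(* Let $k \geq 2$ be an integer and suppose that $q=p^n$ is a prime power ($p$ prime, $n\ge 1$) such that $q \equiv 1 \bmod 2k$. If $k < p^{\frac{n}{2}}+1$, then the generalized Paley graph $\mathcal{P}(q,k)$ is connected.
   Context: For an integer $k\ge 2$ and a finite field $\mathbb{F}_q$ of order $q=p^n$ with $q \equiv 1 \bmod 2k$, let $(\mathbb{F}_q^{\times})^k=\{\alpha\in\mathbb{F}_q^\times \mid \alpha=\beta^k \text{ for some } \beta\in\mathbb{F}_q^\times\}$. The generalized Paley graph $\mathcal{P}(q,k)$ is the simple undirected graph with vertex set $\mathbb{F}_q$ in which $x,y$ are adjacent if and only if $x-y\in(\mathbb{F}_q^\times)^k$. (The congruence guarantees $q$ is odd and $-1\in(\mathbb{F}_q^\times)^k$.) *)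

(* Defs.v *)
From mathcomp Require Import all_boot all_order all_algebra all_field.
Set Implicit Arguments.
Unset Strict Implicit.
Unset Printing Implicit Defensive.

Import GRing.Theory.
Local Open Scope ring_scope.

Definition unit_powers (F : finFieldType) (k : nat) : {set F} :=
  [set a : F | (a != 0) && [exists b : F, (b != 0) && (a == b ^+ k)]].

Definition gen_paley (F : finFieldType) (k : nat) : rel F :=
  fun x y => x - y \in unit_powers F k.
Arguments gen_paley : clear implicits.

(* Directed reachability; for a symmetric e this is the usual notion of being
   joined by a path.  gen_paley_sym below shows that gen_paley is symmetric
   under the congruence #|F| = 1 mod 2k. *)
Definition graph_connected (T : finType) (e : rel T) : Prop :=
  forall x y : T, connect e x y.

Lemma gen_paley_irrefl (F : finFieldType) (k : nat) :
  irreflexive (gen_paley F k).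
Proof. by move=> x; rewrite /gen_paley subrr inE eqxx. Qed.

Lemma unit_powersN1 (F : finFieldType) (k : nat) :
  (#|F| = 1 %[mod 2 * k])%N -> -1 \in unit_powers F k.
Proof.
move=> /eqP; have F_gt1 := finNzRing_gt1 F.
rewrite eqn_mod_dvd 1?ltnW // => /dvdnP[m]; rewrite subn1 => Dq.
have Dh : (#|F|.-1 = (m * k) * 2)%N by rewrite Dq mulnCA mulnC.
have h_gt0 : (0 < m * k)%N.
  by move: F_gt1; rewrite -subn_gt0 subn1 Dh muln_gt0 andbT.
have [x x0 xh] : exists2 x : F, x != 0 & x ^+ (m * k) != 1.
  apply/exists_inP; apply: contraLR h_gt0 => /exists_inPn all1.
  rewrite -leqNgt leqn0; apply: contraT; rewrite -lt0n => h_gt0.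
  have rootsP : all (m * k).-unity_root (enum (predC1 (0 : F))).
    apply/allP=> y; rewrite mem_enum => y0; rewrite unity_rootE.
    by have := all1 y y0; rewrite negbK.
  have := max_unity_roots h_gt0 rootsP (enum_uniq _).
  by rewrite -cardE cardC1 Dh -[leqRHS]muln1 leq_pmul2l.
have {}xh : x ^+ (m * k) = -1.
  have : (x ^+ (m * k)) ^+ 2 == 1.
    rewrite -exprM -Dh; apply/eqP/(mulfI x0).
    by rewrite -exprS prednK ?expf_card ?mulr1 // ltnW.
  by rewrite sqrf_eq1 (negPf xh) => /eqP.
rewrite inE oppr_eq0 oner_eq0 /=; apply/existsP; exists (x ^+ m).
by rewrite expf_neq0 //= -exprM xh.
Qed.

Lemma gen_paley_sym (F : finFieldType) (k : nat) :
  (#|F| = 1 %[mod 2 * k])%N -> symmetric (gen_paley F k).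
Proof.
move=> /unit_powersN1; rewrite inE => /andP[_ /existsP[c /andP[c0 /eqP Dc]]].
suff sub (x y : F) : gen_paley F k x y -> gen_paley F k y x.
  by move=> x y; apply/idP/idP; apply: sub.
rewrite /gen_paley !inE -(opprB x y) oppr_eq0 => /andP[-> /existsP[b /andP[b0 /eqP Db]]].
by apply/existsP; exists (c * b); rewrite mulf_neq0 //= exprMn -Dc mulN1r -Db.
Qed.

(* Main.v *)
Require Import Defs.
From mathcomp Require Import all_boot all_order all_algebra all_field.
From mathcomp Require Import reals exp.
From mathcomp Require Import lra.
Local Open Scope ring_scope.

Import Order.TTheory GRing.Theory Num.Theory.

(** The set K of vertices joined to 0 contains the k-th powers and is closed
    under subtraction and multiplication, so it is a subfield of F. If K were
    proper, then for x outside K the map (a, b) |-> a + b x would be injective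
    on K * K, so |K| <= sqrt q. Each k-th power has at most k roots, and the
    k-th powers lie in K minus 0, hence q - 1 <= k (|K| - 1) <= k (sqrt q - 1)
    and k >= sqrt q + 1. *)

(** In a field with q elements, y^q = y gives y^-1 = y^(q-2) for nonzero y, so inverses are
    products. *)
Lemma finField_subring_divring {F : finFieldType} {K : {set F}} :
  subring_closed K -> divring_closed K.
Proof.
case=> K1 KB KM; split=> // x y Kx Ky; apply: (KM) => //.
have K0 : 0 \in K by rewrite -(subrr 1) KB.
have [->|y0] := eqVneq y 0; first by rewrite invr0.
have F_gt1 := finNzRing_gt1 F.
have -> : y^-1 = y ^+ #|F|.-2.
  apply: (mulfI y0); apply: (mulfI y0); rewrite divff // mulr1 -!exprS.
  by move: F_gt1 (expf_card y); case: #|F| => [|[|m]].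
by elim: (_.-2) => [|m IHm]; rewrite ?expr0 // exprS KM.
Qed.

Lemma card_proper_subring {F : finFieldType} {K : {set F}} :
  subring_closed K -> K != [set: F] -> (#|K| ^ 2 <= #|F|)%N.
Proof.
move=> KR; have [_ KB KV] := finField_subring_divring KR.
rewrite -subTset => /subsetPn[x _ xK].
have inj : {in setX K K &, injective (fun u : F * F => u.1 + u.2 * x)}.
  move=> [a b] [c d] /setXP[/= Ka Kb] /setXP[/= Kc Kd] eq_ac.
  have eqx : (b - d) * x = c - a.
    by rewrite mulrBl -(addKr a (b * x)) eq_ac addrA addrK addrC.
  have [bd|bd] := eqVneq b d.
    by move: eq_ac; rewrite bd => /addIr ->.
  (* If b and d differ, x is the quotient of c - a by b - d, both in [K], which puts x in [K]. *)
  case/negP: xK; have bd0 : b - d != 0 by rewrite subr_eq0.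
  by rewrite -(mulKf bd0 x) eqx mulrC KV ?KB.
by rewrite -mulnn -cardsX -(card_in_imset inj) max_card.
Qed.

Lemma card_unit_powers (F : finFieldType) (k : nat) :
  (0 < k)%N -> (#|F|.-1 <= #|unit_powers F k| * k)%N.
Proof.
move=> k_gt0; rewrite -(cardC1 (0 : F)) -[leqLHS]sum1_card.
rewrite (partition_big (fun x => x ^+ k) (mem (unit_powers F k))) /=; last first.
  move=> x x0; rewrite inE expf_neq0 //=; apply/existsP; exists x.
  by rewrite eqxx andbT.
rewrite -sum_nat_const; apply: leq_sum => s _; rewrite sum1_card cardE.
(* The fibre over s consists of roots of X^k - s, a polynomial of size k + 1. *)
rewrite -ltnS -(size_XnsubC s k_gt0); apply: max_poly_roots.
- by rewrite -size_poly_eq0 size_XnsubC.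
- apply/allP=> x; rewrite mem_enum => /andP[_ /eqP <-].
  by rewrite /root !hornerE subrr.
- exact: enum_uniq.
Qed.

Lemma unit_powersM (F : finFieldType) (k : nat) (a b : F) :
  a \in unit_powers F k -> b \in unit_powers F k -> a * b \in unit_powers F k.
Proof.
rewrite !inE => /andP[a0 /existsP[c /andP[c0 /eqP Da]]].
move=> /andP[b0 /existsP[d /andP[d0 /eqP Db]]]; rewrite mulf_neq0 //=.
by apply/existsP; exists (c * d); rewrite mulf_neq0 //= exprMn -Da -Db.
Qed.

Section Component.
Variables (F : finFieldType) (k : nat).
Hypothesis cardF : (#|F| = 1 %[mod 2 * k])%N.

Let e := gen_paley F k.

Lemma gen_paley_connect_sym : connect_sym e.
Proof. exact/sym_connect_sym/gen_paley_sym. Qed.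

(** Induction along a path; it serves to show that a map carries the component of 0 into itself. *)
Lemma gen_paley_closed_connect (P : pred F) {x y : F} :
  connect e x y -> (forall u v, e u v -> P u -> P v) -> P x -> P y.
Proof.
move=> xy eP Px; have clP := intro_closed gen_paley_connect_sym eP.
by have := closed_connect clP xy; rewrite -!topredE /= Px => <-.
Qed.

(** Adjacency depends only on differences, so translations preserve edges. *)
Lemma gen_paley_connectD (z : F) {x y : F} :
  connect e x y -> connect e (x + z) (y + z).
Proof.
move=> xy; apply: (gen_paley_closed_connect (fun v => connect e (x + z) (v + z)) xy) => //.
move=> u v uv /connect_trans; apply; apply: connect1.
by rewrite /e /gen_paley opprD addrACA subrr addr0.
Qed.

Lemma gen_paley_connectB (x y : F) : connect e x y = connect e 0 (x - y).
Proof.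
rewrite gen_paley_connect_sym; apply/idP/idP => [/(gen_paley_connectD (- y))|].
  by rewrite subrr.
by move=> /(gen_paley_connectD y); rewrite add0r subrK.
Qed.

Lemma unit_powers_connect (s : F) : s \in unit_powers F k -> connect e 0 s.
Proof.
move=> Ss; rewrite gen_paley_connect_sym; apply: connect1.
by rewrite /e /gen_paley subr0.
Qed.

Lemma component_subring : subring_closed [set x | connect e 0 x].
Proof.
(* Multiplication by a k-th power s fixes 0 and preserves edges, as s u - s v = s (u - v). *)
have SM s x : s \in unit_powers F k -> connect e 0 x -> connect e 0 (s * x).
  move=> Ss x0; apply: (gen_paley_closed_connect (fun v => connect e 0 (s * v)) x0).
    move=> u v uv /connect_trans; apply; apply: connect1.
    by rewrite /e /gen_paley -mulrBr unit_powersM.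
  by rewrite mulr0.
have KB x y : connect e 0 x -> connect e 0 y -> connect e 0 (x - y).
  by rewrite -gen_paley_connectB gen_paley_connect_sym; exact: connect_trans.
split=> [|x y|x y]; rewrite !inE; [|exact: KB|].
  rewrite unit_powers_connect // -[1]mulr1 -mulrNN.
  by rewrite unit_powersM ?unit_powersN1.
(* Follow a path from 0 to y: on an edge from u to v, x v = x u - (u - v) x, where u - v is a k-th
   power, so [SM] and [KB] apply. *)
move=> x0 y0; apply: (gen_paley_closed_connect (fun v => connect e 0 (x * v)) y0).
  move=> u v uv xu; rewrite -[v](subKr u) mulrBr KB // mulrC.
  exact: SM.
by rewrite mulr0.
Qed.

End Component.

Theorem theorem1p3 (R : realType) (F : finFieldType) (p n k : nat)
    (p_prime : prime p) (n_ge1 : (1 <= n)%N) (cardF : #|F| = (p ^ n)%N)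
    (k_ge2 : (2 <= k)%N) (q_mod : (p ^ n = 1 %[mod 2 * k])%N)
    (k_lt : (k%:R : R) < (p%:R : R) `^ (n%:R / 2) + 1) :
  graph_connected (gen_paley F k).
Proof.
rewrite -cardF in q_mod.
have KR := component_subring _ _ q_mod.
set K := [set x | _] in KR.
suff KT : K = [set: F].
  move=> x y; rewrite gen_paley_connectB //.
  by have := in_setT (x - y); rewrite -KT inE.
apply/eqP; apply: contraT => /(card_proper_subring KR) K2.
have F_gt1 := finNzRing_gt1 F.
have [K1 _ _] := KR.
have K0 : 0 \in K by rewrite inE connect0.
have SK : unit_powers F k \subset K :\ 0.
  apply/subsetP=> s Ss; rewrite !inE unit_powers_connect // andbT.
  by move: Ss; rewrite inE => /andP[].
have K_gt0 : (0 < #|K :\ 0%R|)%N.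
  by apply/card_gt0P; exists 1; rewrite in_setD1 oner_neq0.
have := leq_trans (card_unit_powers F k (ltnW k_ge2))
  (leq_mul (subset_leq_card SK) (leqnn k)).
rewrite (cardsD1 0) K0 add1n in K2.
set m := #|K :\ 0%R| in K_gt0 K2 *.
set r := (p%:R : R) `^ _ in k_lt.
have r_ge0 : 0 <= r by exact: powR_ge0.
have r2 : r * r = #|F|%:R.
  rewrite -expr2 -powR_mulrn // -powRrM divfK ?pnatr_eq0 //.
  by rewrite powR_mulrn // cardF natrX.
move: K2 K_gt0 k_lt; rewrite -!(ler_nat R) -mulnn !natrM -natr1 -subn1.
rewrite natrB 1?ltnW // -r2.
(* With M = |K| - 1, c = k and r = sqrt q, the contradiction is r^2 - 1 <= M c < M (r + 1) <= (r -
   1) (r + 1); the strict step uses M >= 1. *)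
move: (m%:R : R) (k%:R : R) => M c MM M1 cr qk.
have Mr : M + 1 <= r by nra.
have : M * c < M * (r + 1) by rewrite ltr_pM2l // (lt_le_trans ltr01).
have : M * (r + 1) <= (r - 1) * (r + 1).
  by rewrite ler_pM2r ?lerBrDr // ltr_wpDl.
lra.
Qed.
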